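(* Let $\mathcal{B}=\{b_1,b_2,b_3,\dots\}$ be a sequence of integers greater than $1$ such that $b_i$ and $b_j$ are relatively prime for $i\neq j$ and $\sum_i 1/b_i<\infty$. Suppose that $2\notin\mathcal{B}$ and that the counting function $\mathcal{N}^{\mathcal{B}}(N)=\#\{n\in\mathcal{Z}^{\mathcal{B}}: 1\le n\le N\}$ of the $\mathcal{B}$-integers satisfies $\mathcal{N}^{\mathcal{B}}(N)=A\,N^{\alpha}+O(N^{\beta})$ as $N\to\infty$, for some constants $A>0$ and $0\le\beta<\alpha<1$. Then for any integer $N\ge1$ the limit $\lim_{X\to\infty}P_{\mathcal{B}}(X,N)$ exists and, as $N\to\infty$, $$\lim_{X\to\infty}P_{\mathcal{B}}(X,N)\lesssim N^{\alpha-2}.$$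
   Context: A positive integer is called $\mathcal{B}$-free if it is not divisible by any element of $\mathcal{B}$; $\mu^{\mathcal{B}}(n)$ equals $1$ if $n$ is $\mathcal{B}$-free and $0$ otherwise. The set $\mathcal{Z}^{\mathcal{B}}$ of $\mathcal{B}$-integers is the multiplicative semigroup generated by $\mathcal{B}$ (including $1$, the empty product). For positive integers $X,N$, let $\mathbb{P}_X$ be the uniform distribution on $\{1,\dots,X\}$ and let $$P_{\mathcal{B}}(X,N)=\mathbb{P}_X\left\{x: 1\le x\le X,\ \sum_{x\le n<x+N}\mu^{\mathcal{B}}(n)=0\right\},$$ the proportion of intervals $[x,x+N)$ with $1\le x\le X$ containing no $\mathcal{B}$-free number. The notation $f(N)\lesssim g(N)$ means that there are a positive constant $C$ (which may depend on $\mathcal{B}$) and $N_0$ with $f(N)\le C\,g(N)$ for all $N\ge N_0$. *)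

(* Defs.v *)
From HB Require Import structures.
From mathcomp Require Import all_boot all_order all_algebra.
From mathcomp Require Import all_classical all_reals all_analysis.

Set Implicit Arguments.
Unset Strict Implicit.
Unset Printing Implicit Defensive.

Local Open Scope classical_set_scope.
Local Open Scope nat_scope.

Definition B_free (B : set nat) (n : nat) : Prop :=
  0 < n /\ forall b, B b -> ~~ (b %| n).

Definition mu_B (B : set nat) (n : nat) : nat := `[< B_free B n >].

Definition mul_monoid (S : set nat) : Prop :=
  S 1 /\ forall m n, S m -> S n -> S (m * n).

Definition B_integers (B : set nat) : set nat := smallest mul_monoid B.

Definition count_B_integers (B : set nat) (N : nat) : nat :=
  count (fun n => `[< B_integers B n >]) (iota 1 N).

(* The uniform distribution on {1, ..., X}; at X = 0 it takes the junk value 0,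
   which does not affect limits as X tends to infinity. *)
Definition prob_unif (R : realType) (X : nat) (E : pred nat) : R :=
  ((count E (iota 1 X))%:R / X%:R)%R.

Definition P_B (R : realType) (B : set nat) (X N : nat) : R :=
  prob_unif R X (fun x => \sum_(x <= n < x + N) mu_B B n == 0).

Definition lesssim (R : realType) (f g : nat -> R) : Prop :=
  exists2 C : R, (0 < C)%R &
    exists N0 : nat, forall N, N0 <= N -> (f N <= C * g N)%R.

(* Main.v *)
Require Import Defs.
From HB Require Import structures.
From mathcomp Require Import all_boot all_order all_algebra.
From mathcomp Require Import all_classical all_reals all_analysis.
From mathcomp Require Import unstable ring lra.

Set Implicit Arguments.
Unset Strict Implicit.
Unset Printing Implicit Defensive.

Import Order.TTheory GRing.Theory Num.Theory.
Import numFieldNormedType.Exports.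

Local Open Scope classical_set_scope.
Local Open Scope ring_scope.

(** The number S(x) of B-free integers in [x, x + N) has mean c N, where c is
    the product of the 1 - 1/b_i, and variance O(N^alpha).  An interval without
    B-free integers deviates from the mean by c N, so by Chebyshev the frequency
    of such intervals is O(N^alpha / (c N)^2) = O(N^(alpha - 2)).  Since
    sum 1/b_i converges, c is positive.

    Means and variances are computed for the sieve by the first K moduli only,
    where they are exact averages over the period b_0 ... b_(K-1), and all
    bounds are uniform in K.  By the Chinese remainder theorem
    ([sum_prod_coprime]) the correlation of the sieve at m and n is
    prod_i (1 - 2/b_i + [m = n mod b_i]/b_i) ([sum_sieved2]).  Expanding the
    product over the subsets I of {0, ..., K-1}, with d_I the product of the
    b_i for i in I, gives sum_I w_I [m = n mod d_I] where
    0 <= w_I <= 1/d_I.  Summed over m, n < N, the indicator equals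
    N^2/d + O(min(d, N)) ([congruent_pairs]); the terms N^2/d_I add up to the
    squared mean exactly ([density_sqr]), and the variance is at most
    sum_I min(1, N/d_I) ([variance_sieved_le]).  The d_I are distinct
    B-integers, so the upper bound O(n^alpha) for their counting function and a
    dyadic decomposition bound this sum by O(N^alpha) ([sum_min1_le]); here
    alpha < 1 makes the geometric series converge.

    Finally, the moduli b_i with i >= K meet an interval of length N starting
    at most at X with frequency at most N (N + 1) sum_(i >= K) 1/b_i
    ([P_B_truncation]), and a periodic set has a density ([periodic_frequency]).
    Hence P_B(X, N) is eventually within any e of the density of the K-sieve
    gaps for some K ([P_B_approx]); this yields both the Cauchy property in X
    and the transfer of the uniform bound to the limit. *)

(** * Averages over residue classes *)

Lemma sum_mul_coprime (R : comNzRingType) (a c : nat) (F G : nat -> R) :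
  (0 < a)%N -> (0 < c)%N -> coprime a c ->
  (forall n, F (n %% a)%N = F n) -> (forall n, G (n %% c)%N = G n) ->
  \sum_(x < a * c) F x * G x = (\sum_(u < a) F u) * (\sum_(v < c) G v).
Proof.
move=> a_gt0 c_gt0 co_ac Fper Gper; rewrite big_distrlr /= pair_big /=.
pose h (x : 'I_(a * c)) : 'I_a * 'I_c :=
  (Ordinal (ltn_pmod x a_gt0), Ordinal (ltn_pmod x c_gt0)).
have h_inj : injective h.
  move=> x y [/eqP hx /eqP hy]; apply/val_inj/eqP; rewrite /=.
  by rewrite -(modn_small (ltn_ord x)) -(modn_small (ltn_ord y))
    chinese_remainder // hx hy.
have h_bij : bijective h by apply: inj_card_bij; rewrite // card_prod !card_ord.
rewrite (reindex h) /=; last exact: onW_bij.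
by apply: eq_bigr => x _; rewrite Fper Gper.
Qed.

(** Residues modulo pairwise coprime b_i are independent: sums of products of
    b_i-periodic functions over a full period factor. *)
Lemma sum_prod_coprime (R : comNzRingType) (b : nat -> nat) (f : nat -> nat -> R) :
  (forall i, (0 < b i)%N) -> (forall i j, i <> j -> coprime (b i) (b j)) ->
  (forall i n, f i (n %% b i)%N = f i n) ->
  forall K, \sum_(x < \prod_(i < K) b i) \prod_(i < K) f i x
            = \prod_(i < K) \sum_(x < b i) f i x.
Proof.
move=> b_gt0 b_co f_per; elim=> [|K IH].
  by rewrite big_ord0 big_ord1 !big_ord0.
rewrite !big_ord_recr /=.
under eq_bigr do rewrite big_ord_recr /=.
rewrite -IH.
apply: (sum_mul_coprime (F := fun x => \prod_(i < K) f i x)) => //.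
- by rewrite prodn_gt0.
- rewrite coprime_sym; elim/(@big_ind nat): _ => [|x y hx hy|i _].
  + by rewrite coprimen1.
  + by rewrite coprimeMr hx.
  + by apply: b_co => eKi; move: (ltn_ord i); rewrite -eKi ltnn.
- move=> n; apply: eq_bigr => i _; rewrite -(f_per i (n %% _)%N) -[RHS]f_per.
  by rewrite modn_dvdm // (bigD1 i) //= dvdn_mulr.
Qed.

Lemma sum_dvdn_shift (d m : nat) : (0 < d)%N ->
  (\sum_(x < d) (d %| x + m) = 1)%N.
Proof.
move=> d_gt0; pose x0 := Ordinal (ltn_pmod (d - m %% d) d_gt0).
have x0m : (d %| x0 + m)%N.
  by rewrite /dvdn /= modnDml -modnDmr subnK ?modnn // ltnW // ltn_pmod.
rewrite (bigD1 x0) //= x0m big1 // => x /eqP x_neq.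
apply/eqP; rewrite eqb0; apply/negP => xm; case: x_neq; apply/val_inj/eqP.
rewrite -[val x](modn_small (ltn_ord x)) -[val x0](modn_small (ltn_ord x0)).
by rewrite -(eqn_modDr m) (eqP xm) (eqP x0m).
Qed.

Lemma sum_not_dvdn (R : comNzRingType) (d m : nat) : (0 < d)%N ->
  \sum_(x < d) (~~ (d %| x + m)%N)%:R = d%:R - 1 :> R.
Proof.
move=> d_gt0.
have -> : d%:R - 1
    = \sum_(x < d) 1 - (\sum_(x < d) (d %| x + m))%N%:R :> R.
  by rewrite sumr_const card_ord sum_dvdn_shift.
rewrite natr_sum -sumrB; apply: eq_bigr => x _.
by case: (d %| x + m)%N; rewrite ?subr0 ?subrr.
Qed.

(** Two residue classes are removed from the d available ones, or only one
    when they coincide. *)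
Lemma sum_not_dvdn2 (R : comNzRingType) (d m n : nat) : (0 < d)%N ->
  \sum_(x < d) (~~ (d %| x + m)%N)%:R * (~~ (d %| x + n)%N)%:R
  = d%:R - 2 + (m == n %[mod d])%:R :> R.
Proof.
move=> d_gt0.
have E (x : 'I_d) : (~~ (d %| x + m)%N)%:R * (~~ (d %| x + n)%N)%:R
  = (~~ (d %| x + m)%N)%:R - (d %| x + n)%N%:R
    + (m == n %[mod d])%:R * (d %| x + m)%N%:R :> R.
  have [mn|nmn] := eqVneq (m %% d)%N (n %% d)%N.
    have -> : (d %| x + n)%N = (d %| x + m)%N.
      by rewrite /dvdn -modnDmr -mn modnDmr.
    by case: (d %| x + m)%N => /=; ring.
  have [xm|] := boolP (d %| x + m)%N; have [xn|] := boolP (d %| x + n)%N => /= *;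
    try ring.
  by case/negP: nmn; rewrite -(eqn_modDl x) (eqP xm) (eqP xn).
under eq_bigr do rewrite E.
rewrite big_split sumrB /= -mulr_sumr sum_not_dvdn // -!natr_sum.
by rewrite !sum_dvdn_shift //; ring.
Qed.

Lemma sum_congr_below (d N : nat) :
  (\sum_(n < N) (N == n %[mod d]) = N %/ d)%N.
Proof.
rewrite divn_count_dvd big_add1 /= big_mkord (reindex_inj rev_ord_inj) /=.
by apply: eq_bigr => n _; rewrite eqn_mod_dvd ?leq_subr // subKn.
Qed.

(** With r = N mod d, passing from N to N + 1 adds the diagonal pair (N, N) and
    twice the N / d smaller integers congruent to N, so the identity follows by
    induction, with a separate case when r + 1 = d wraps around. *)
Lemma congruent_pairs (d N : nat) : (0 < d)%N ->
  (d * (\sum_(m < N) \sum_(n < N) (m == n %[mod d]))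
   = N ^ 2 + (N %% d) * (d - N %% d))%N.
Proof.
move=> d_gt0; elim: N => [|N IH]; first by rewrite big_ord0 mod0n muln0 mul0n.
rewrite big_ord_recr /= big_ord_recr /= eqxx sum_congr_below.
under eq_bigr => m _ do rewrite big_ord_recr /= eq_sym.
rewrite big_split /= sum_congr_below !mulnDr IH.
have := divn_eq N d; set q := (N %/ d)%N; set r := (N %% d)%N => EN.
have [e Ed] : exists e, d = (r + e).+1.
  by exists (d - r.+1)%N; rewrite -addSn subnKC // ltn_pmod.
have -> : (d - r = e.+1)%N by rewrite Ed -addnS addKn.
have [e0|e_gt0] := posnP e.
  have -> : (N.+1 %% d = 0)%N by rewrite EN -addnS modnMDl Ed e0 addn0 modnn.
  by rewrite EN Ed e0 mul0n; ring.
have -> : (N.+1 %% d = r.+1)%N.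
  by rewrite EN -addnS modnMDl modn_small // Ed ltnS -[ltnLHS]addn0 ltn_add2l.
have -> : (d - r.+1 = e)%N by rewrite Ed -addSn addKn.
by rewrite EN Ed; ring.
Qed.

(** * Variance of the finite sieve *)

Definition sieved (b : nat -> nat) (K n : nat) : bool :=
  [forall i : 'I_K, ~~ (b i %| n)%N].

Definition sieve_gap (b : nat -> nat) (K N x : nat) : bool :=
  [forall j : 'I_N, ~~ sieved b K (x + j)].

Lemma sievedE (R : comNzRingType) (b : nat -> nat) (K n : nat) :
  (sieved b K n)%:R = \prod_(i < K) (~~ (b i %| n)%N)%:R :> R.
Proof.
have [free|/forallPn[i /negPn bi_dvd]] := boolP (sieved b K n).
  by rewrite big1 // => i _; rewrite (forallP free i).
by rewrite (bigD1 i) //= bi_dvd mul0r.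
Qed.

Lemma count_iota1 (P : pred nat) (M : nat) :
  (count P (iota 1 M) = \sum_(x < M) P x.+1)%N.
Proof.
have -> : iota 1 M = index_iota 1 M.+1 by rewrite /index_iota subn1.
rewrite -sum1_count big_mkcond.
by rewrite big_add1 big_mkord; apply: eq_bigr => x _; case: (P _).
Qed.

Section FiniteSieve.
Variables (R : realFieldType) (b : nat -> nat).
Hypothesis b_gt1 : forall i, (1 < b i)%N.
Hypothesis b_coprime : forall i j, i <> j -> coprime (b i) (b j).

Definition period (K : nat) : nat := \prod_(i < K) b i.

Definition density (K : nat) : R := \prod_(i < K) (1 - (b i)%:R^-1).

Definition subproduct (K : nat) (I : {set 'I_K}) : nat := \prod_(i in I) b i.

Definition weight (K : nat) (I : {set 'I_K}) : R :=
  \prod_i (if i \in I then (b i)%:R^-1 else 1 - 2 / (b i)%:R).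

Let b_gt0 i : (0 < b i)%N.
Proof. exact: ltnW. Qed.

Let b_neq0 i : (b i)%:R != 0 :> R.
Proof. by rewrite pnatr_eq0 -lt0n b_gt0. Qed.

Lemma period_gt0 K : (0 < period K)%N.
Proof. by rewrite prodn_gt0 // => i; exact: b_gt0. Qed.

Lemma subproduct_gt0 K (I : {set 'I_K}) : (0 < subproduct I)%N.
Proof. by rewrite prodn_gt0 // => i; exact: b_gt0. Qed.

Lemma sum_sieved K m :
  \sum_(x < period K) (sieved b K (x + m))%:R = (period K)%:R * density K :> R.
Proof.
under eq_bigr do rewrite sievedE.
rewrite (sum_prod_coprime (f := fun i x => (~~ (b i %| x + m)%N)%:R)) //.
- rewrite /period natr_prod -big_split /=; apply: eq_bigr => i _.
  by rewrite sum_not_dvdn ?b_gt0 // mulrBr mulr1 divff ?b_neq0.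
- by move=> i n; rewrite /dvdn modnDml.
Qed.

Lemma sum_sieved2 K m n :
  \sum_(x < period K) (sieved b K (x + m))%:R * (sieved b K (x + n))%:R
  = (period K)%:R * \prod_(i < K)
      ((m == n %[mod b i])%:R / (b i)%:R + (1 - 2 / (b i)%:R)) :> R.
Proof.
under eq_bigr do rewrite !sievedE -big_split /=.
rewrite (sum_prod_coprime (f := fun i x =>
  (~~ (b i %| x + m)%N)%:R * (~~ (b i %| x + n)%N)%:R)) //.
- rewrite /period natr_prod -big_split /=; apply: eq_bigr => i _.
  by rewrite sum_not_dvdn2 ?b_gt0 //; field; exact: b_neq0.
- by move=> i x; rewrite /dvdn !modnDml.
Qed.

(** Expanding the product over subsets serves twice: with y_i the indicator of
    m = n mod b_i it gives the correlations, and with y_i = 1/b_i the squared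
    density. *)
Lemma prod_weight K (y : 'I_K -> R) :
  \prod_i (y i / (b i)%:R + (1 - 2 / (b i)%:R))
  = \sum_(I : {set 'I_K}) weight I * \prod_(i in I) y i.
Proof.
rewrite bigA_distr; apply: eq_bigr => I _.
rewrite /weight [X in _ * X]big_mkcond -big_split /=; apply: eq_bigr => i _.
by case: ifP => _; rewrite ?mulr1 // mulrC.
Qed.

Lemma congr_subproduct K (I : {set 'I_K}) m n :
  \prod_(i in I) (m == n %[mod b i])%:R = (m == n %[mod subproduct I])%:R :> R.
Proof.
wlog le_nm : m n / (n <= m)%N.
  move=> H; case/orP: (leq_total n m) => [/H//|/H].
  by rewrite eq_sym => <-; apply: eq_bigr => i _; rewrite eq_sym.
rewrite eqn_mod_dvd //; under eq_bigr do rewrite eqn_mod_dvd //.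
have pw : pairwise coprime [seq b (i : 'I_K) | i <- index_enum 'I_K & i \in I].
  rewrite pairwise_map; apply: (@sub_pairwise _ (fun x y => x != y)).
    by move=> x y /eqP xy; apply: b_coprime => /val_inj.
  by rewrite -uniq_pairwise filter_uniq // index_enum_uniq.
have [dv|ndv] := boolP (subproduct I %| m - n)%N.
  rewrite big1 // => i iI.
  by move/(Gauss_dvd_prod _ pw): dv => ->; rewrite ?mem_index_enum.
have [i iI ni] : exists2 i, i \in I & ~~ (b i %| m - n)%N.
  apply/exists_inP; rewrite -negb_forall_in; apply: contra ndv => /forall_inP dv.
  by apply/(Gauss_dvd_prod _ pw) => i _ /dv.
by rewrite (bigD1 i) //= (negbTE ni) mul0r.
Qed.

(** (1 - 1/b)^2 = 1 - 2/b + (1/b)(1/b), so the squared mean has the same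
    expansion as the correlations, with each indicator of a congruence modulo
    d_I replaced by its average 1/d_I. *)
Lemma density_sqr K :
  density K ^+ 2 = \sum_(I : {set 'I_K}) weight I / (subproduct I)%:R.
Proof.
rewrite expr2 -big_split /=.
under [RHS]eq_bigr do rewrite /subproduct natr_prod -prodfV.
rewrite -(prod_weight (fun i => (b i)%:R^-1)); apply: eq_bigr => i _.
by field; exact: b_neq0.
Qed.

(** The main terms N^2/d_I are those of the squared mean, so that only the
    excess of pairs congruent modulo d_I over its expected number remains. *)
Lemma variance_sieved K N :
  \sum_(x < period K)
     (\sum_(j < N) (sieved b K (x.+1 + j))%:R - density K * N%:R) ^+ 2
  = (period K)%:R * \sum_(I : {set 'I_K}) weight I *
      ((\sum_(m < N) \sum_(n < N) (m == n %[mod subproduct I]))%N%:R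
        - N%:R ^+ 2 / (subproduct I)%:R) :> R.
Proof.
pose s n : R := (sieved b K n)%:R.
(* Open the square and move the sum over x inside. *)
have -> : \sum_(x < period K)
     (\sum_(j < N) (sieved b K (x.+1 + j))%:R - density K * N%:R) ^+ 2
  = \sum_(m < N) \sum_(n < N) \sum_(x < period K) s (x + m.+1)%N * s (x + n.+1)%N
    - 2 * density K * N%:R * (\sum_(j < N) \sum_(x < period K) s (x + j.+1)%N)
    + (period K)%:R * (density K * N%:R) ^+ 2.
  under eq_bigr do under eq_bigr do rewrite addSnnS.
  under eq_bigr do rewrite sqrrB.
  rewrite big_split sumrB /= sumr_const card_ord -[_ *+ period K]mulr_natl.
  congr (_ - _ + _).
    under [RHS]eq_bigr do rewrite exchange_big /=.
    rewrite exchange_big /=; apply: eq_bigr => x _.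
    by rewrite expr2 big_distrlr.
  rewrite exchange_big /= mulr_sumr; apply: eq_bigr => x _.
  by rewrite /s -mulr_natl; ring.
under eq_bigr do under eq_bigr do rewrite sum_sieved2.
under [X in _ - _ * X]eq_bigr do rewrite sum_sieved.
rewrite sumr_const card_ord -[_ * _ *+ N]mulr_natl.
have -> : \sum_(i < N) \sum_(j < N) (period K)%:R * (\prod_(k < K)
     (((i.+1 == j.+1 %[mod b k])%:R / (b k)%:R) + (1 - 2 / (b k)%:R)))
  = (period K)%:R * \sum_(I : {set 'I_K}) weight I *
      (\sum_(m < N) \sum_(n < N) (m == n %[mod subproduct I]))%N%:R.
  under eq_bigr do rewrite -mulr_sumr.
  rewrite -mulr_sumr; congr (_ * _).
  under eq_bigr => i _.
    under eq_bigr => j _.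
      rewrite (prod_weight (fun k : 'I_K => (i.+1 == j.+1 %[mod b k])%:R)).
      under eq_bigr do rewrite congr_subproduct.
      over.
    over.
  under eq_bigr do rewrite exchange_big /=.
  rewrite exchange_big /=; apply: eq_bigr => I _.
  rewrite natr_sum mulr_sumr; apply: eq_bigr => m _.
  rewrite natr_sum mulr_sumr; apply: eq_bigr => n _.
  by rewrite (eqn_modDl 1).
under [X in _ = _ * X]eq_bigr do rewrite mulrBr.
rewrite sumrB.
have -> : \sum_(I : {set 'I_K}) weight I * (N%:R ^+ 2 / (subproduct I)%:R)
  = N%:R ^+ 2 * density K ^+ 2.
  rewrite density_sqr mulr_sumr; apply: eq_bigr => I _; ring.
by ring.
Qed.

(** The excess equals r (d - r) / d with r = N mod d, hence is at most r. *)
Lemma pairs_excess_le (d N : nat) : (0 < d)%N ->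
  (\sum_(m < N) \sum_(n < N) (m == n %[mod d]))%N%:R - N%:R ^+ 2 / d%:R
  <= Num.min d%:R N%:R :> R.
Proof.
move=> d_gt0; have := congruent_pairs N d_gt0.
set T := (\sum_(m < N) _)%N => E.
have dR : 0 < d%:R :> R by rewrite ltr0n.
have -> : T%:R - N%:R ^+ 2 / d%:R = (N %% d)%:R * (d - N %% d)%:R / d%:R :> R.
  have : (d * T)%:R = (N ^ 2 + (N %% d) * (d - N %% d))%N%:R :> R by rewrite E.
  rewrite natrD natrX !natrM => ER.
  by apply: (mulfI (lt0r_neq0 dR)); rewrite mulrBr ER; field; rewrite lt0r_neq0.
have le_r : (N %% d)%:R * (d - N %% d)%:R / d%:R <= (N %% d)%:R :> R.
  by rewrite ler_pdivrMr // -!natrM ler_nat leq_mul2l leq_subr orbT.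
by rewrite le_min !(le_trans le_r) // ler_nat ?leq_mod // ltnW // ltn_pmod.
Qed.

(** The factors 1 - 2/b_i with i outside I lie between 0 and 1. *)
Lemma weight_bounds K (I : {set 'I_K}) :
  0 <= weight I <= (subproduct I)%:R^-1.
Proof.
have b2 (i : 'I_K) : 0 <= (1 - 2 / (b i)%:R : R) <= 1.
  have b_pos : 0 < (b i)%:R :> R by rewrite ltr0n b_gt0.
  rewrite subr_ge0 gerBl divr_ge0 // andbT.
  by rewrite ler_pdivrMr // mul1r ler_nat b_gt1.
have -> : (subproduct I)%:R^-1
    = \prod_i (if i \in I then (b i)%:R^-1 else 1) :> R.
  by rewrite /subproduct natr_prod -prodfV big_mkcond.
rewrite prodr_ge0 /= => [|i _].
  apply: ler_prod => i _; case: ifP => _ //.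
  by rewrite invr_ge0 ler0n lexx.
by case: ifP => _; [rewrite invr_ge0|case/andP: (b2 i)].
Qed.

Lemma variance_sieved_le K N :
  \sum_(x < period K)
     (\sum_(j < N) (sieved b K (x.+1 + j))%:R - density K * N%:R) ^+ 2
  <= (period K)%:R
     * \sum_(I : {set 'I_K}) Num.min 1 (N%:R / (subproduct I)%:R).
Proof.
rewrite variance_sieved ler_wpM2l //; apply: ler_sum => I _.
have /andP[w_ge0 w_le] := weight_bounds I.
have d_gt0 := subproduct_gt0 I.
have dR : 0 < (subproduct I)%:R :> R by rewrite ltr0n.
apply: le_trans (ler_wpM2l w_ge0 (pairs_excess_le N d_gt0)) _.
have m_ge0 : 0 <= Num.min (subproduct I)%:R N%:R :> R by rewrite le_min !ler0n.
apply: le_trans (ler_wpM2r m_ge0 w_le) _.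
by rewrite minr_pMr ?invr_ge0 // mulVf ?lt0r_neq0 // mulrC.
Qed.

(** Chebyshev: each gap contributes the squared mean to the sum of squared
    deviations. *)
Lemma count_gaps_le K N :
  (count (sieve_gap b K N) (iota 1 (period K)))%:R * (density K * N%:R) ^+ 2
  <= (period K)%:R
     * \sum_(I : {set 'I_K}) Num.min 1 (N%:R / (subproduct I)%:R).
Proof.
apply: le_trans (variance_sieved_le K N).
rewrite count_iota1 natr_sum mulr_suml; apply: ler_sum => x _.
have [/forallP gap|_] := boolP (sieve_gap b K N x.+1); last first.
  by rewrite mul0r sqr_ge0.
rewrite mul1r.
by rewrite big1 ?sub0r ?sqrrN // => j _; rewrite (negbTE (gap j)).
Qed.

End FiniteSieve.

(** * The second moment in terms of the counting function *)

Section SievedProducts.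
Variable b : nat -> nat.
Hypothesis b_gt1 : forall i, (1 < b i)%N.
Hypothesis b_coprime : forall i j, i <> j -> coprime (b i) (b j).

(** A b_i with i outside I is coprime to d_I, so I can be read off from d_I. *)
Lemma mem_subproduct K (I : {set 'I_K}) (i : 'I_K) :
  (b i %| subproduct b I)%N = (i \in I).
Proof.
have [iI|niI] := boolP (i \in I).
  by rewrite /subproduct (bigD1 i) // dvdn_mulr.
apply/negbTE/negP => i_dvd.
have : coprime (b i) (subproduct b I).
  rewrite /subproduct; elim/(@big_ind nat): _ => [|x y hx hy|j jI].
  - by rewrite coprimen1.
  - by rewrite coprimeMr hx.
  - by apply: b_coprime => /val_inj eij; move: niI; rewrite eij jI.
by move/coprime_dvdr => /(_ _ i_dvd); rewrite /coprime gcdnn gtn_eqF.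
Qed.

Lemma subproduct_inj K : injective (@subproduct b K).
Proof. by move=> I J eIJ; apply/setP => i; rewrite -!mem_subproduct eIJ. Qed.

Lemma B_integers_subproduct K (I : {set 'I_K}) :
  B_integers (range b) (subproduct b I).
Proof.
move=> S [[S1 SM] bS]; rewrite /subproduct; elim/(@big_ind nat): _ => //.
by move=> i _; apply: bS; exists (i : nat).
Qed.

Lemma card_subproduct_le K Y :
  (#|[pred I : {set 'I_K} | subproduct b I <= Y]|
   <= count_B_integers (range b) Y)%N.
Proof.
rewrite /count_B_integers cardE -(size_map (@subproduct b K)) -size_filter.
apply: uniq_leq_size => [|d /mapP[I]].
  by rewrite map_inj_uniq ?enum_uniq //; exact: subproduct_inj.
rewrite mem_enum inE => dY ->; rewrite mem_filter mem_iota add1n ltnS dY.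
rewrite subproduct_gt0 // !andbT; apply/asboolP; exact: B_integers_subproduct.
Qed.

End SievedProducts.

(** The least j with d <= 2^j N already suffices: if j > 0, then
    d > 2^(j - 1) N, that is N / d < 2 / 2^j.  The bound J makes the sum
    finite. *)
Lemma min1_dyadic (R : realFieldType) (N d J : nat) :
  (0 < d)%N -> (d <= 2 ^ J * N)%N ->
  Num.min 1 (N%:R / d%:R)
  <= \sum_(j < J.+1) 2 / 2 ^+ j * (d <= 2 ^ j * N)%N%:R :> R.
Proof.
move=> d_gt0 dJ; have ex_j : exists j, (d <= 2 ^ j * N)%N by exists J.
case: (ex_minnP ex_j) => j dj j_min.
have j_lt : (j < J.+1)%N by rewrite ltnS j_min.
have dR : 0 < d%:R :> R by rewrite ltr0n.
rewrite (bigD1 (Ordinal j_lt)) //= dj mulr1.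
apply: le_trans (_ : 2 / 2 ^+ j <= _); last first.
  by rewrite lerDl sumr_ge0.
case: j dj j_min {j_lt} => [|j] dj j_min; rewrite ge_min.
  by rewrite expr0 divr1 ler1n.
apply/orP; right; rewrite exprS invfM mulrA divff // mul1r.
rewrite ler_pdivrMr // ler_pdivlMl ?exprn_gt0 // -natrX -natrM ler_nat.
by rewrite leqNgt; apply/negP => /ltnW /j_min; rewrite ltnn.
Qed.

Lemma geometric_sum_le (R : realFieldType) (q : R) (n : nat) :
  0 <= q < 1 -> \sum_(j < n) q ^+ j <= (1 - q)^-1.
Proof.
case/andP=> q_ge0 q_lt1; have q1 : 0 < 1 - q by rewrite subr_gt0.
rewrite -[leRHS]mul1r ler_pdivlMr // mulrC.
have -> : (1 - q) * \sum_(j < n) q ^+ j = 1 - q ^+ n.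
  by rewrite -[RHS]opprB subrX1 -mulNr opprB.
by rewrite gerBl exprn_ge0.
Qed.

Lemma powR2_half_bounds (R : realType) (alpha : R) :
  alpha < 1 -> 0 <= 2 `^ alpha / 2 < (1 : R).
Proof.
move=> alpha_lt1; rewrite divr_ge0 ?powR_ge0 //= ltr_pdivrMr // mul1r.
rewrite -[ltRHS]powRr1 // /powR pnatr_eq0 /= ltr_expR ltr_pM2r //.
by rewrite ln_gt0 // ltr1n.
Qed.

(** After the dyadic decomposition, the level j counts the d_I up to 2^j N with
    weight 2 / 2^j, which gives at most 2 C N^alpha (2^alpha / 2)^j. *)
Lemma sum_min1_le (R : realType) (b : nat -> nat) (alpha C : R) (K N : nat) :
  (forall i, (1 < b i)%N) -> (forall i j, i <> j -> coprime (b i) (b j)) ->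
  alpha < 1 -> 0 <= C ->
  (forall n, (0 < n)%N ->
     (count_B_integers (range b) n)%:R <= C * n%:R `^ alpha) ->
  (0 < N)%N ->
  \sum_(I : {set 'I_K}) Num.min 1 (N%:R / (subproduct b I)%:R)
  <= 2 * C / (1 - 2 `^ alpha / 2) * N%:R `^ alpha.
Proof.
move=> b_gt1 b_co alpha_lt1 C_ge0 count_le N_gt0.
(* Every d_I divides the period, and n < 2^n, so J levels reach all of them. *)
pose J := period b K.
have dJ (I : {set 'I_K}) : (subproduct b I <= 2 ^ J * N)%N.
  apply: leq_trans (_ : J <= _)%N.
    apply: dvdn_leq; first exact: period_gt0.
    rewrite /J /period (bigID (mem I)) /=; exact: dvdn_mulr.
  by apply: leq_trans (leq_pmulr _ N_gt0); rewrite ltnW // ltn_expl.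
pose q : R := 2 `^ alpha / 2.
have q_bounds : 0 <= q < 1 := powR2_half_bounds alpha_lt1.
apply: le_trans (_ : \sum_(I : {set 'I_K}) \sum_(j < J.+1)
    2 / 2 ^+ j * (subproduct b I <= 2 ^ j * N)%N%:R <= _).
  by apply: ler_sum => I _; rewrite min1_dyadic // subproduct_gt0.
rewrite exchange_big /=.
apply: le_trans (_ : \sum_(j < J.+1) (2 * C * N%:R `^ alpha) * q ^+ j <= _).
  apply: ler_sum => j _; rewrite -mulr_sumr -natr_sum.
  have -> : (\sum_(I : {set 'I_K}) (subproduct b I <= 2 ^ j * N)
     = #|[pred I : {set 'I_K} | subproduct b I <= 2 ^ j * N]|)%N.
    rewrite -sum1_card [RHS]big_mkcond /=; apply: eq_bigr => I _.
    by rewrite inE; case: leqP.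
  apply: le_trans (_ : 2 / 2 ^+ j * (C * (2 ^ j * N)%:R `^ alpha) <= _).
    rewrite ler_wpM2l ?divr_ge0 ?exprn_ge0 //.
    apply: le_trans (count_le _ _); last by rewrite muln_gt0 expn_gt0.
    by rewrite ler_nat card_subproduct_le.
  have -> : (2 ^ j * N)%:R `^ alpha = (2 `^ alpha) ^+ j * N%:R `^ alpha :> R.
    rewrite natrM natrX powRM ?exprn_ge0 //; congr (_ * _).
    rewrite -(powR_mulrn j (ler0n R 2)) -powRrM mulrC powRrM.
    by rewrite powR_mulrn // powR_ge0.
  rewrite /q expr_div_n le_eqVlt; apply/orP; left; apply/eqP; ring.
rewrite -mulr_sumr.
have -> : 2 * C / (1 - 2 `^ alpha / 2) * N%:R `^ alpha
    = 2 * C * N%:R `^ alpha * (1 - q)^-1 by rewrite /q; ring.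
by rewrite ler_wpM2l ?geometric_sum_le // !mulr_ge0 ?powR_ge0.
Qed.

(** Past some n0 the asymptotic formula gives the constant A + k, as
    n^beta <= n^alpha; below n0 the trivial bound by n0 is absorbed using
    1 <= n^alpha. *)
Lemma count_B_integers_le (R : realType) (B : set nat) (A alpha beta : R) :
  0 < A -> 0 <= beta -> beta < alpha ->
  (fun N : nat => (count_B_integers B N)%:R : R)
     = (fun N : nat => A * N%:R `^ alpha) +O_\oo (fun N : nat => N%:R `^ beta) ->
  exists2 C : R, 0 < C & forall n, (0 < n)%N ->
    (count_B_integers B n)%:R <= C * n%:R `^ alpha.
Proof.
move=> A_gt0 beta_ge0 beta_lt /eqaddOP /bigO_exP [k k_gt0 [n0 _ bound]].
exists (A + k + n0%:R) => [|n n_gt0]; first by rewrite ltr_wpDr // addr_gt0.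
have n1 : 1 <= n%:R :> R by rewrite ler1n.
have pow_ge1 (t : R) : 0 <= t -> 1 <= n%:R `^ t.
  by move=> t_ge0; rewrite -[leLHS](powRr0 n%:R) ler_powR.
have alpha_pow : 1 <= n%:R `^ alpha.
  by rewrite pow_ge1 // (le_trans beta_ge0) // ltW.
have [n0_le|n_lt] := leqP n0 n; last first.
  apply: le_trans (_ : n0%:R <= _).
    rewrite ler_nat (leq_trans (count_size _ _)) // size_iota; exact: ltnW.
  apply: le_trans (_ : n0%:R * n%:R `^ alpha <= _); first by rewrite ler_peMr.
  rewrite ler_wpM2r ?powR_ge0 // lerDr ltW // addr_gt0 //.
have := bound n n0_le; rewrite /= -[(_ - _) n]/(_ - _).
rewrite (ger0_norm (powR_ge0 _ _)) ler_norml => /andP[_].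
rewrite lerBlDl => /le_trans; apply.
rewrite mulrDl mulrDl -addrA lerD2l.
apply: le_trans (_ : k * n%:R `^ alpha <= _).
  by rewrite ler_wpM2l ?(ltW k_gt0) // ler_powR // ltW.
by rewrite lerDl mulr_ge0 // powR_ge0.
Qed.

(** * Truncation of the sieve and periodicity *)

Definition B_gap (b : nat -> nat) (N x : nat) : bool :=
  (\sum_(x <= n < x + N) mu_B (range b) n == 0)%N.

Lemma B_gapE (b : nat -> nat) (N x : nat) :
  B_gap b N x = [forall j : 'I_N, ~~ `[< B_free (range b) (x + j) >]].
Proof.
rewrite /B_gap -{1}[x]add0n big_addn addKn big_mkord sum_nat_eq0.
by apply: eq_forallb => j; rewrite /mu_B addnC eqb0.
Qed.

Lemma B_free_sieved (b : nat -> nat) (K n : nat) :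
  B_free (range b) n -> sieved b K n.
Proof. by case=> _ bn; apply/forallP => i; apply: bn; exists (i : nat). Qed.

Lemma sieve_gap_B_gap (b : nat -> nat) (K N x : nat) :
  sieve_gap b K N x -> B_gap b N x.
Proof.
move=> /forallP gap; rewrite B_gapE; apply/forallP => j.
by apply: contra (gap j) => /asboolP; exact: B_free_sieved.
Qed.

(** Finitely many integers below Y are involved, so finitely many moduli detect
    all of those that are not B-free. *)
Lemma sieve_level (b : nat -> nat) (Y : nat) :
  exists L, forall n, (0 < n < Y)%N ->
    ~ B_free (range b) n -> exists2 i, (i < L)%N & (b i %| n)%N.
Proof.
elim: Y => [|Y [L HL]]; first by exists 0%N => n; rewrite ltn0 andbF.
have [[i bi]|no_dvd] := pselect (exists i, (b i %| Y)%N).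
  exists (maxn L i.+1) => n /andP[n_gt0]; rewrite ltnS leq_eqVlt.
  case/predU1P => [->|nY] nfree.
    by exists i => //; rewrite leq_max ltnS leqnn orbT.
  have [|k kL bk] := HL n _ nfree; first by rewrite n_gt0.
  by exists k => //; rewrite leq_max kL.
exists L => n /andP[n_gt0]; rewrite ltnS leq_eqVlt.
case/predU1P => [eY|nY] nfree; last by apply: HL => //; rewrite n_gt0.
case: nfree; split=> // _ [i _ <-]; apply/negP => bi; apply: no_dvd.
by exists i; rewrite -eY.
Qed.

(** A gap that the first K moduli do not produce contains an integer that they
    leave in place, and this integer must be removed by a later modulus. *)
Lemma B_gap_le (b : nat -> nat) (K L N Y x : nat) :
  (forall n, (0 < n < Y)%N -> ~ B_free (range b) n ->
     exists2 i, (i < L)%N & (b i %| n)%N) ->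
  (0 < x)%N -> (x + N <= Y)%N ->
  (B_gap b N x <= sieve_gap b K N x
                  + \sum_(K <= i < L) \sum_(j < N) (b i %| x + j))%N.
Proof.
move=> HL x_gt0 xY; have [gapB|//] := boolP (B_gap b N x).
have [//|/forallPn[j /negPn/forallP free_j]] := boolP (sieve_gap b K N x).
have [||i iL bi] := HL (x + j)%N.
- by rewrite addn_gt0 x_gt0 (leq_trans _ xY) // ltn_add2l.
- by move: gapB; rewrite B_gapE => /forallP/(_ j)/asboolPn.
have Ki : (K <= i)%N.
  by rewrite leqNgt; apply/negP => iK; have := free_j (Ordinal iK); rewrite bi.
rewrite add0n (big_cat_nat (n := i)) //= ?(ltnW iL) // addnC big_ltn //.
by rewrite (bigD1 j) //= bi.
Qed.

(** L depends on X; later bounds use only that the sums of 1/b_i are bounded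
    uniformly in L. *)
Lemma count_B_gap_le (b : nat -> nat) (K N X : nat) :
  exists L, (count (B_gap b N) (iota 1 X)
    <= count (sieve_gap b K N) (iota 1 X)
       + N * \sum_(K <= i < L) (X + N) %/ b i)%N.
Proof.
have [L HL] := sieve_level b (X + N).+1; exists L.
rewrite !count_iota1.
apply: leq_trans (_ : \sum_(x < X) (sieve_gap b K N x.+1
  + \sum_(K <= i < L) \sum_(j < N) (b i %| x.+1 + j)) <= _)%N.
  apply: leq_sum => x _; apply: (B_gap_le _ HL) => //.
  by rewrite addSn ltnS leq_add2r ltnW.
rewrite big_split /= leq_add2l exchange_big big_distrr /=.
apply: leq_sum => i _; rewrite exchange_big /=.
rewrite -[X in (X * _)%N]card_ord -sum_nat_const; apply: leq_sum => j _.
rewrite divn_count_dvd big_add1 /= big_mkord addnC.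
have jN : (j + X <= N + X)%N by rewrite leq_add2r ltnW.
rewrite -(subnKC jN) big_split_ord /= -[leqLHS]addn0 leq_add //.
rewrite big_split_ord /= -[leqLHS]add0n leq_add //.
by apply: leq_sum => x _; rewrite addSn addnC.
Qed.

Lemma count_periodic (P : pred nat) (M q r : nat) :
  (forall x, P (M + x)%N = P x) ->
  (count P (iota 1 (q * M + r))
   = q * count P (iota 1 M) + count P (iota 1 r))%N.
Proof.
move=> P_per; elim: q => [//|q IH].
rewrite !mulSn -!addnA -IH !count_iota1 big_split_ord /=; congr (_ + _)%N.
by apply: eq_bigr => x _; rewrite -addnS P_per.
Qed.

(** Writing X = q M + r, the complete periods have the exact frequency, and the
    remainder contributes at most r <= M in the numerator. *)
Lemma periodic_frequency (R : realFieldType) (P : pred nat) (M X : nat) :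
  (0 < M)%N -> (0 < X)%N -> (forall x, P (M + x)%N = P x) ->
  `|(count P (iota 1 X))%:R / X%:R - (count P (iota 1 M))%:R / M%:R|
  <= M%:R / X%:R :> R.
Proof.
move=> M_gt0 X_gt0 P_per.
have MR : 0 < M%:R :> R by rewrite ltr0n.
have XR : 0 < X%:R :> R by rewrite ltr0n.
set c := count P (iota 1 M); set r := (X %% M)%N.
set e := count P (iota 1 r).
have EX : X = (X %/ M * M + r)%N := divn_eq X M.
have -> : count P (iota 1 X) = (X %/ M * c + e)%N.
  by rewrite [in LHS]EX count_periodic.
have c_le : c%:R <= M%:R :> R.
  by rewrite ler_nat (leq_trans (count_size _ _)) // size_iota.
have r_le : r%:R <= M%:R :> R by rewrite ler_nat ltnW // ltn_pmod.
have e_le : e%:R <= M%:R :> R.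
  by apply: le_trans r_le; rewrite ler_nat (leq_trans (count_size _ _)) //
    size_iota.
(* Cross-multiplying cancels the contribution of the complete periods. *)
have -> : (X %/ M * c + e)%N%:R / X%:R - c%:R / M%:R
    = (e%:R * M%:R - c%:R * r%:R) / M%:R / X%:R :> R.
  have EXR : X%:R = (X %/ M)%:R * M%:R + r%:R :> R.
    by rewrite [in LHS]EX natrD natrM.
  rewrite natrD natrM.
  have -> : r%:R = X%:R - (X %/ M)%:R * M%:R :> R by rewrite EXR addrAC subrr add0r.
  by field; rewrite !lt0r_neq0.
rewrite normrM normfV (gtr0_norm XR) ler_wpM2r ?invr_ge0 //.
rewrite normrM normfV (gtr0_norm MR) ler_pdivrMr //.
have h1 : e%:R * M%:R <= M%:R * M%:R :> R by rewrite ler_wpM2r.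
have h2 : c%:R * r%:R <= M%:R * M%:R :> R by rewrite ler_pM.
have h3 : 0 <= e%:R * M%:R :> R by rewrite mulr_ge0.
have h4 : 0 <= c%:R * r%:R :> R by rewrite mulr_ge0.
by rewrite ler_norml; lra.
Qed.

Lemma sieve_gap_periodic (b : nat -> nat) (K N x : nat) :
  sieve_gap b K N (period b K + x) = sieve_gap b K N x.
Proof.
apply: eq_forallb => j; congr (~~ _); apply: eq_forallb => i; congr (~~ _).
by rewrite -addnA dvdn_addr // /period (bigD1 i) //= dvdn_mulr.
Qed.

(** * Limits *)

Lemma expR_le_onem (R : realType) (x : R) :
  0 <= x <= 1 / 2 -> expR (- (2 * x)) <= 1 - x.
Proof.
case/andP=> x_ge0 x_le; rewrite expRN -div1r ler_pdivrMr ?expR_gt0 //.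
apply: le_trans (_ : (1 - x) * (1 + 2 * x) <= _); first by nra.
by rewrite ler_wpM2l ?expR_ge1Dx //; lra.
Qed.

(** Since b_i >= 2, each factor is at least exp(-2/b_i); this keeps the mean
    density of the sieve away from 0 uniformly in K. *)
Lemma density_ge (R : realType) (b : nat -> nat) (S : R) (K : nat) :
  (forall i, (1 < b i)%N) -> \sum_(i < K) (b i)%:R^-1 <= S ->
  expR (- (2 * S)) <= density R b K.
Proof.
move=> b_gt1 S_ge.
apply: le_trans (_ : expR (\sum_(i < K) - (2 * (b i)%:R^-1)) <= _).
  by rewrite ler_expR sumrN -mulr_sumr lerN2 ler_pM2l.
rewrite expR_sum; apply: ler_prod => i _; rewrite expR_ge0 /=.
apply: expR_le_onem; rewrite invr_ge0 ler0n /= div1r.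
by rewrite lef_pV2 ?posrE ?ltr0n ?ler_nat // ltnW.
Qed.

(** Chebyshev with the second moment O(N^alpha) and the mean at least
    exp(-2 S) N; the constant does not depend on K. *)
Lemma sieve_gap_frequency_le (R : realType) (b : nat -> nat) (alpha C S : R)
    (K N : nat) :
  (forall i, (1 < b i)%N) -> (forall i j, i <> j -> coprime (b i) (b j)) ->
  alpha < 1 -> 0 <= C ->
  (forall n, (0 < n)%N ->
     (count_B_integers (range b) n)%:R <= C * n%:R `^ alpha) ->
  \sum_(i < K) (b i)%:R^-1 <= S -> (0 < N)%N ->
  (count (sieve_gap b K N) (iota 1 (period b K)))%:R / (period b K)%:R
  <= 2 * C / (1 - 2 `^ alpha / 2) / expR (- (2 * S)) ^+ 2
     * N%:R `^ (alpha - 2).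
Proof.
move=> b_gt1 b_co alpha_lt1 C_ge0 count_le S_ge N_gt0.
have NR : 0 < N%:R :> R by rewrite ltr0n.
have MR : 0 < (period b K)%:R :> R by rewrite ltr0n period_gt0.
have c_gt0 : 0 < expR (- (2 * S)) by exact: expR_gt0.
have c_le := density_ge b_gt1 S_ge.
have cheb := count_gaps_le R b_gt1 b_co K N.
have moment := sum_min1_le K b_gt1 b_co alpha_lt1 C_ge0 count_le N_gt0.
set V := 2 * C / (1 - 2 `^ alpha / 2) in moment *.
set c := expR (- (2 * S)) in c_gt0 c_le *.
set p := count _ _ in cheb *.
have -> : V / c ^+ 2 * N%:R `^ (alpha - 2)
    = V * N%:R `^ alpha / (c * N%:R) ^+ 2.
  rewrite powRB ?pnatr_eq0 -?lt0n ?N_gt0 ?implybT //.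
  by rewrite powR_mulrn // exprMn [in RHS]invfM; ring.
rewrite ler_pdivlMr ?exprn_gt0 ?mulr_gt0 // mulrAC ler_pdivrMr //.
apply: le_trans (_ : p%:R * (density R b K * N%:R) ^+ 2 <= _).
  rewrite ler_wpM2l // ler_sqr ?nnegrE ?mulr_ge0 ?ler_wpM2r //; try exact: ltW.
  by apply: le_trans c_le; exact: ltW.
by apply: le_trans cheb _; rewrite mulrC ler_wpM2r // ltW.
Qed.

Lemma series_inv_le (R : realType) (b : nat -> nat) :
  cvgn (series (fun i => ((b i)%:R)^-1 : R)) ->
  forall K, \sum_(i < K) (b i)%:R^-1
            <= limn (series (fun i => ((b i)%:R)^-1 : R)).
Proof.
move=> cvg_b K; rewrite -(big_mkord xpredT (fun i => (b i)%:R^-1)).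
apply: (nondecreasing_cvgn_le (u_ := series (fun i => ((b i)%:R)^-1 : R))) => //.
by apply: nondecreasing_series => i _ _; rewrite invr_ge0.
Qed.

(** The K-sieve gaps are B-gaps; the others are counted by the multiples of the
    b_i with i >= K, and X + N <= X (N + 1). *)
Lemma P_B_truncation (R : realType) (b : nat -> nat) (S : R) (K N X : nat) :
  (forall i, (0 < b i)%N) -> (0 < X)%N ->
  (forall L, \sum_(i < L) (b i)%:R^-1 <= S) ->
  `|P_B R (range b) X N - (count (sieve_gap b K N) (iota 1 X))%:R / X%:R|
  <= N%:R * N.+1%:R * (S - \sum_(i < K) (b i)%:R^-1).
Proof.
move=> b_gt0 X_gt0 S_ge.
have XR : 0 < X%:R :> R by rewrite ltr0n.
rewrite /P_B /prob_unif -/(B_gap b N) -mulrBl.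
have [L cnt_le] := count_B_gap_le b K N X.
rewrite normrM normfV (gtr0_norm XR) ler_pdivrMr //.
rewrite ger0_norm; last first.
  by rewrite subr_ge0 ler_nat sub_count // => x; exact: sieve_gap_B_gap.
rewrite lerBlDl; apply: le_trans (_ : (count (sieve_gap b K N) (iota 1 X)
  + N * \sum_(K <= i < L) (X + N) %/ b i)%N%:R <= _); first by rewrite ler_nat.
rewrite natrD lerD2l natrM natr_sum -!mulrA ler_wpM2l //.
have tail_le : \sum_(K <= i < L) (b i)%:R^-1
    <= S - \sum_(i < K) (b i)%:R^-1 :> R.
  have [LK|/ltnW KL] := leqP L K; first by rewrite big_geq // subr_ge0.
  rewrite lerBrDl; apply: le_trans (S_ge L).
  by rewrite -!(big_mkord xpredT (fun i => (b i)%:R^-1)) -big_cat_nat.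
apply: le_trans (_ : (X + N)%N%:R * \sum_(K <= i < L) (b i)%:R^-1 <= _).
  rewrite mulr_sumr; apply: ler_sum => i _.
  by rewrite ler_pdivlMr ?ltr0n // -natrM ler_nat leq_trunc_div.
rewrite [_ * X%:R]mulrC mulrA -natrM ler_pM ?ler_nat ?sumr_ge0 //.
by rewrite mulSn leq_add2l leq_pmulr.
Qed.

Lemma P_B_approx (R : realType) (b : nat -> nat) (N : nat) (e : R) :
  (forall i, (0 < b i)%N) -> (0 < N)%N ->
  cvgn (series (fun i => ((b i)%:R)^-1 : R)) -> 0 < e ->
  exists K, \forall X \near \oo,
    `|P_B R (range b) X N
      - (count (sieve_gap b K N) (iota 1 (period b K)))%:R / (period b K)%:R|
    < e.
Proof.
move=> b_gt0 N_gt0 cvg_b e_gt0.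
have S_ge := series_inv_le cvg_b.
set S := limn _ in S_ge.
have NN : 0 < N%:R * N.+1%:R :> R by rewrite mulr_gt0 // ltr0n.
have eN : 0 < e / 2 / (N%:R * N.+1%:R) by rewrite !divr_gt0.
have [K0 _ tail] : \forall K \near \oo,
    `|S - series (fun i => ((b i)%:R)^-1 : R) K| < e / 2 / (N%:R * N.+1%:R).
  by apply: cvgr_dist_lt eN; exact: cvg_b.
exists K0; have := tail K0 (leqnn K0).
rewrite /= /series /= big_mkord ger0_norm ?subr_ge0 // => {}tail.
have M_gt0 : (0 < period b K0)%N by rewrite prodn_gt0.
near=> X.
have X_gt0 : (0 < X)%N by near: X; exact: nbhs_infty_gt.
have XR : 0 < X%:R :> R by rewrite ltr0n.
apply: le_lt_trans
  (ler_distD ((count (sieve_gap b K0 N) (iota 1 X))%:R / X%:R) _ _) _.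
rewrite [ltRHS]splitr ltr_leD //.
  apply: le_lt_trans (P_B_truncation K0 N b_gt0 X_gt0 S_ge) _.
  by rewrite mulrC -ltr_pdivlMr.
apply: le_trans (periodic_frequency R M_gt0 X_gt0 (sieve_gap_periodic b K0 N)) _.
rewrite ler_pdivrMr // mulrC -ler_pdivrMr ?divr_gt0 //.
by near: X; exact: nbhs_infty_ger.
Unshelve. all: by end_near. Qed.

Theorem mainTheorem2 (R : realType) (b : nat -> nat)
    (b_gt1 : forall i, (1 < b i)%N)
    (b_coprime : forall i j, i <> j -> coprime (b i) (b j))
    (b_summable : cvgn (series (fun i => ((b i)%:R)^-1 : R)))
    (b_neq2 : ~ range b 2%N)
    (A alpha beta : R)
    (A_gt0 : 0 < A)
    (beta_ge0 : 0 <= beta) (beta_lt_alpha : beta < alpha) (alpha_lt1 : alpha < 1)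
    (b_count :
      (fun N : nat => (count_B_integers (range b) N)%:R : R)
        = (fun N : nat => A * N%:R `^ alpha)
          +O_\oo (fun N : nat => N%:R `^ beta)) :
  (forall N : nat, (1 <= N)%N -> cvgn (fun X => P_B R (range b) X N)) /\
  lesssim (fun N => limn (fun X => P_B R (range b) X N))
          (fun N => N%:R `^ (alpha - 2)).
Proof.
have b_gt0 i : (0 < b i)%N by exact: ltnW.
have cvg_P N : (0 < N)%N -> cvgn (fun X => P_B R (range b) X N).
  move=> N_gt0; apply/cauchy_cvgP/cauchy_exP => e e_gt0.
  have [K approx] := P_B_approx b_gt0 N_gt0 b_summable e_gt0.
  exists ((count (sieve_gap b K N) (iota 1 (period b K)))%:R / (period b K)%:R).
  by apply: filterS approx => X; rewrite /ball /= distrC.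
split=> //.
have [C C_gt0 count_le] := count_B_integers_le A_gt0 beta_ge0 beta_lt_alpha b_count.
have S_ge := series_inv_le b_summable.
set S := limn _ in S_ge.
pose D := 2 * C / (1 - 2 `^ alpha / 2) / expR (- (2 * S)) ^+ 2.
exists D.
  rewrite divr_gt0 ?exprn_gt0 ?expR_gt0 // divr_gt0 ?mulr_gt0 //.
  by case/andP: (powR2_half_bounds alpha_lt1) => _; rewrite subr_gt0.
exists 1%N => N N_gt0; apply/ler_addgt0Pr => e e_gt0.
apply: limr_le; first exact: cvg_P.
have [K approx] := P_B_approx b_gt0 N_gt0 b_summable e_gt0.
apply: filterS approx => X; rewrite ltr_norml ltrBlDl => /andP[_ /ltW].
move=> /le_trans; apply; rewrite lerD2r.
exact: sieve_gap_frequency_le (ltW C_gt0) count_le (S_ge K) N_gt0.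
Qed.
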